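(* Every deduction in $\mathbf{I}$ in normal form has the subformula property: every formula occurring in it is a subformula either of its conclusion or of one of its undischarged assumptions.
   Context: Formulas of intuitionistic propositional logic are built from atomic formulas using the connectives $\bot$ (0-ary), $\land$, $\lor$, $\supset$; $\bot$ is not atomic. Subformulas are defined as usual (each formula is a subformula of itself). The natural deduction system $\mathbf{I}$ has tree-shaped deductions with assumptions at the leaves, grouped into assumption classes (occurrences of the same formula; a rule discharging a class discharges all its members). Rules: - $\land I$: from deductions of $A$, of $B$, and of $C$ from $[A\land B]$, conclude $C$. - $\supset I$: from a deduction of $B$ from $[A]$ and a deduction of $C$ from $[A\supset B]$, conclude $C$. - $\lor I$: from a deduction of $A$ (or of $B$) and a deduction of $C$ from $[A\lor B]$, conclude $C$. - $\land E$: from $A\land B$ and a deduction of $C$ from $[A],[B]$, conclude $C$. - $\supset E$: from $A\supset B$, $A$, and a deduction of $C$ from $[B]$, conclude $C$. - $\lor E$: from $A\lor B$, a deduction of $C$ from $[A]$ and one of $C$ from $[B]$, conclude $C$. - $\bot E$: from $\bot$ conclude $C$. A single assumption occurrence is a deduction. Standing conventions: no vacuous discharge above arbitrary premises; $\bot E$ has atomic conclusions. In elimination rules, $A\land B,A\supset B,A\lor B,\bot$ are major premises and the $C$'s are arbitrary premises; in introduction rules the $C$ is the arbitrary premise and the discharged $A\land B, A\supset B, A\lor B$ are major assumptions discharged. A maximal formula with main operator $\ast$ is an occurrence of $A\ast B$ that is both the major premise of $\ast E$ and a major assumption discharged by $\ast I$. A segment is a sequence $C_1,\dots,C_n$ ($n>1$)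 of occurrences of the same formula, each $C_i$ ($i<n$) an arbitrary premise of a rule with conclusion $C_{i+1}$, and $C_n$ not an arbitrary premise. A maximal segment is a segment whose last formula is the major premise of an elimination rule. A deduction is in normal form if it contains no maximal formula and no maximal segment. *)

(* Defs.v *)
From Stdlib Require Import List.
Import ListNotations.

Set Implicit Arguments.

Inductive formula (atom : Type) : Type :=
| Atom (a : atom)
| Bot
| And (A B : formula atom)
| Or (A B : formula atom)
| Imp (A B : formula atom).

Arguments Bot {atom}.

Inductive subformula (atom : Type) (F : formula atom) : formula atom -> Prop :=
| sub_refl : subformula F F
| sub_And1 A B : subformula F A -> subformula F (And A B)
| sub_And2 A B : subformula F B -> subformula F (And A B)
| sub_Or1 A B : subformula F A -> subformula F (Or A B)
| sub_Or2 A B : subformula F B -> subformula F (Or A B)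
| sub_Imp1 A B : subformula F A -> subformula F (Imp A B)
| sub_Imp2 A B : subformula F B -> subformula F (Imp A B).

(* An assumption occurrence carries a label; its assumption class consists of
   the occurrences of the same formula with the same label.  A rule names the
   classes it discharges by their labels, the formulas being determined by the
   rule.  A label is an argument placed just before the deduction above which
   the corresponding class is discharged. *)
Definition label := nat.

Inductive deduction (atom : Type) : formula atom -> Type :=
| Assumption (A : formula atom) (x : label) : deduction A
| AndI (A B C : formula atom) :
    deduction A -> deduction B ->
    forall x : label (* [And A B] *), deduction C -> deduction C
| ImpI (A B C : formula atom) :
    forall x : label (* [A] *), deduction B ->
    forall y : label (* [Imp A B] *), deduction C -> deduction C
| OrI1 (A B C : formula atom) :
    deduction A ->
    forall x : label (* [Or A B] *), deduction C -> deduction C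
| OrI2 (A B C : formula atom) :
    deduction B ->
    forall x : label (* [Or A B] *), deduction C -> deduction C
| AndE (A B C : formula atom) :
    deduction (And A B) ->
    forall x y : label (* [A], [B] *), deduction C -> deduction C
| ImpE (A B C : formula atom) :
    deduction (Imp A B) -> deduction A ->
    forall x : label (* [B] *), deduction C -> deduction C
| OrE (A B C : formula atom) :
    deduction (Or A B) ->
    forall x : label (* [A] *), deduction C ->
    forall y : label (* [B] *), deduction C -> deduction C
| BotE (C : formula atom) : deduction Bot -> deduction C.

(* [Minor] covers all premises that are neither major nor arbitrary. *)
Variant role := Major | Minor | Arbitrary.

Record premise (atom : Type) := Premise {
  premise_role : role;
  premise_discharges : list (formula atom * label);
  premise_formula : formula atom;
  premise_deduction : deduction premise_formula }.

Arguments Premise {atom} premise_role premise_discharges {premise_formula}.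

Definition premises (atom : Type) (C : formula atom) (d : deduction C) :
    list (premise atom) :=
  match d with
  | Assumption _ _ => []
  | @AndI _ A B _ d1 d2 x d3 =>
      [Premise Minor [] d1; Premise Minor [] d2;
       Premise Arbitrary [(And A B, x)] d3]
  | @ImpI _ A B _ x d1 y d2 =>
      [Premise Minor [(A, x)] d1; Premise Arbitrary [(Imp A B, y)] d2]
  | @OrI1 _ A B _ d1 x d2 =>
      [Premise Minor [] d1; Premise Arbitrary [(Or A B, x)] d2]
  | @OrI2 _ A B _ d1 x d2 =>
      [Premise Minor [] d1; Premise Arbitrary [(Or A B, x)] d2]
  | @AndE _ A B _ d1 x y d2 =>
      [Premise Major [] d1; Premise Arbitrary [(A, x); (B, y)] d2]
  | @ImpE _ A B _ d1 d2 x d3 =>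
      [Premise Major [] d1; Premise Minor [] d2;
       Premise Arbitrary [(B, x)] d3]
  | @OrE _ A B _ d1 x d2 y d3 =>
      [Premise Major [] d1; Premise Arbitrary [(A, x)] d2;
       Premise Arbitrary [(B, y)] d3]
  | BotE _ d1 => [Premise Major [] d1]
  end.

Definition is_introduction (atom : Type) (C : formula atom) (d : deduction C) :
    bool :=
  match d with
  | AndI _ _ _ _ | ImpI _ _ _ _ _ | OrI1 _ _ _ _ | OrI2 _ _ _ _ => true
  | _ => false
  end.

(* A position is a path from the root (the conclusion of the deduction) to a
   node; formula occurrences are identified with positions. *)
Definition position := list nat.

Section Occurrences.

Variable atom : Type.

Fixpoint subdeduction (C : formula atom) (d : deduction C) (p : position) :
    option {B : formula atom & deduction B} :=
  match p with
  | [] => Some (existT _ C d)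
  | k :: p' =>
      match nth_error (premises d) k with
      | Some pr => subdeduction (premise_deduction pr) p'
      | None => None
      end
  end.

Variables (C : formula atom) (d : deduction C).

Definition occurs_at (p : position) (F : formula atom) : Prop :=
  exists e : deduction F, subdeduction d p = Some (existT _ F e).

Definition assumption_at (p : position) (F : formula atom) (x : label) : Prop :=
  subdeduction d p = Some (existT _ F (Assumption F x)).

Definition introduction_at (q : position) : Prop :=
  exists (B : formula atom) (e : deduction B),
    subdeduction d q = Some (existT _ B e) /\ is_introduction e = true.

(* [pr] is the [k]-th premise, counted from 0, of the rule whose conclusion is
   the occurrence [q]; this premise is the occurrence [q ++ [k]]. *)
Definition premise_at (q : position) (k : nat) (pr : premise atom) : Prop :=
  exists (B : formula atom) (e : deduction B),
    subdeduction d q = Some (existT _ B e) /\ nth_error (premises e) k = Some pr.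

Definition premise_of_role (r : role) (p q : position) : Prop :=
  exists (k : nat) (pr : premise atom),
    p = q ++ [k] /\ premise_at q k pr /\ premise_role pr = r.

(* [p] lies above the [k]-th premise of the rule with conclusion [q], and that
   rule discharges the class [(F, x)] above this premise. *)
Definition in_scope (p q : position) (k : nat) (F : formula atom) (x : label) :
    Prop :=
  (exists r : position, p = q ++ k :: r) /\
  exists pr : premise atom,
    premise_at q k pr /\ In (F, x) (premise_discharges pr).

(* Labels may be reused: an occurrence is discharged by the first rule below it
   that discharges its class. *)
Definition discharged_by (p q : position) (k : nat) : Prop :=
  exists (F : formula atom) (x : label),
    assumption_at p F x /\ in_scope p q k F x /\
    forall (q' : position) (k' : nat),
      in_scope p q' k' F x -> length q' <= length q.

Definition undischarged_assumption (p : position) (F : formula atom) : Prop :=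
  (exists x : label, assumption_at p F x) /\
  ~ exists (q : position) (k : nat), discharged_by p q k.

Definition no_vacuous_discharge : Prop :=
  forall (q : position) (k : nat) (pr : premise atom),
    premise_at q k pr -> premise_role pr = Arbitrary ->
    exists p : position, discharged_by p q k.

Definition BotE_atomic : Prop :=
  forall (q : position) (B : formula atom) (e : deduction Bot),
    subdeduction d q = Some (existT _ B (BotE B e)) ->
    exists a : atom, B = Atom a.

Definition major_premise (p : position) : Prop :=
  exists q : position, premise_of_role Major p q.

Definition discharged_major_assumption (p : position) : Prop :=
  exists (q : position) (k : nat) (pr : premise atom),
    discharged_by p q k /\ introduction_at q /\
    premise_at q k pr /\ premise_role pr = Arbitrary.

(* The main operators of the two rules agree, both being the main operator of
   the formula at [p]. *)
Definition maximal_formula (p : position) : Prop :=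
  major_premise p /\ discharged_major_assumption p.

Definition segment (s : list position) : Prop :=
  1 < length s /\
  (exists F : formula atom, forall p : position, In p s -> occurs_at p F) /\
  (forall (i : nat) (p q : position),
     nth_error s i = Some p -> nth_error s (S i) = Some q ->
     premise_of_role Arbitrary p q) /\
  ~ exists q : position, premise_of_role Arbitrary (last s []) q.

Definition maximal_segment (s : list position) : Prop :=
  segment s /\ major_premise (last s []).

Definition normal_form : Prop :=
  (~ exists p : position, maximal_formula p) /\
  (~ exists s : list position, maximal_segment s).

Definition subformula_property : Prop :=
  forall (p : position) (F : formula atom),
    occurs_at p F ->
    subformula F C \/
    exists (q : position) (G : formula atom),
      undischarged_assumption q G /\ subformula F G.

End Occurrences.

(* Main.v *)
(** Every occurrence is followed to another occurrence of which it is a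
    subformula.  An arbitrary premise leads down to the conclusion of its rule,
    which is the same formula.  A minor premise leads to a strictly larger
    formula: the major premise of its elimination or, as discharge is not
    vacuous, a major assumption discharged by its introduction.  By normality a
    major premise is an assumption; if it is discharged, the rule that
    discharges it also has such a strictly larger formula.  Since formula size
    is bounded in a deduction, the search ends, and it can only end at the
    conclusion or at an undischarged assumption. *)

From Stdlib Require Import List Lia Classical.
Require Import Defs.
Import ListNotations.

Set Implicit Arguments.

Section Formulas.

Variable atom : Type.
Implicit Types F G H : formula atom.

Fixpoint formula_size F : nat :=
  match F with
  | Atom _ | Bot => 0
  | And A B | Or A B | Imp A B => S (formula_size A + formula_size B)
  end.

Lemma subformula_trans F G H :
  subformula F G -> subformula G H -> subformula F H.
Proof. intros HFG HGH; induction HGH; auto using subformula. Qed.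

(** The size clause is what makes a chain of such steps terminate. *)
Definition proper_subformula F G : Prop :=
  subformula F G /\ formula_size F < formula_size G.

End Formulas.

Ltac solve_proper_subformula :=
  split; simpl; [auto using subformula | lia].

Section Rules.

Variables (atom : Type) (C : formula atom) (d : deduction C).

Lemma arbitrary_premise_formula (pr : premise atom) :
  In pr (premises d) -> premise_role pr = Arbitrary -> premise_formula pr = C.
Proof.
  destruct d; simpl; intuition; subst; simpl in *; congruence.
Qed.

Lemma major_premise_not_atomic (pr : premise atom) (a : atom) :
  In pr (premises d) -> premise_role pr = Major -> premise_formula pr <> Atom a.
Proof.
  destruct d; simpl; intuition; subst; simpl in *; congruence.
Qed.

(** These are the possible ways to reach a major premise: normality will exclude the third, and
    atomic conclusions of [BotE] the second. *)
Lemma deduction_last_rule :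
  (exists x, d = Assumption C x) \/ (exists e, d = BotE C e) \/
  (exists k pr, nth_error (premises d) k = Some pr /\
     premise_role pr = Arbitrary).
Proof.
  destruct d; [left; eauto | right; right .. | right; left; eauto].
  all: try solve [exists 1; simpl; eauto].
  all: exists 2; simpl; eauto.
Qed.

(* [G] is the formula whose main operator is introduced or eliminated by the
   last rule of [d]. *)
Definition principal_formula (G : formula atom) : Prop :=
  exists k pr, nth_error (premises d) k = Some pr /\
    ((premise_role pr = Major /\ premise_formula pr = G) \/
     (premise_role pr = Arbitrary /\
      exists y, premise_discharges pr = [(G, y)])).

Lemma minor_premise_principal (pr : premise atom) :
  In pr (premises d) -> premise_role pr = Minor ->
  exists G, principal_formula G /\ proper_subformula (premise_formula pr) G.
Proof.
  unfold principal_formula.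
  destruct d; simpl; intuition; subst; simpl in *; try discriminate.
  all: eexists; split;
    (* Premise 0 is the major premise of an elimination; an introduction has its arbitrary premise
       at 1 or 2. *)
    [ first [ exists 0; eexists; split; [reflexivity |];
              left; split; reflexivity
            | exists 1; eexists; split; [reflexivity |];
              right; split; [reflexivity | eexists; reflexivity]
            | exists 2; eexists; split; [reflexivity |];
              right; split; [reflexivity | eexists; reflexivity] ]
    | solve_proper_subformula ].
Qed.

(** The first alternative is the discharge of a major assumption. Otherwise the class is a component
    of the major premise of an elimination, or the antecedent discharged by [ImpI]. *)
Lemma discharged_class_principal (pr : premise atom) F x :
  In pr (premises d) -> In (F, x) (premise_discharges pr) ->
  (is_introduction d = true /\ premise_role pr = Arbitrary) \/
  exists G, principal_formula G /\ proper_subformula F G.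
Proof.
  unfold principal_formula.
  destruct d; simpl; intuition; subst; simpl in *; intuition; try congruence.
  all: match goal with H : (_, _) = (_, _) |- _ => injection H; intros; subst end.
  all: right; eexists; split;
    [ first [ exists 0; eexists; split; [reflexivity |];
              left; split; reflexivity
            | exists 1; eexists; split; [reflexivity |];
              right; split; [reflexivity | eexists; reflexivity] ]
    | solve_proper_subformula ].
Qed.

End Rules.

Lemma deduction_premises_ind (atom : Type)
  (P : forall C : formula atom, deduction C -> Prop) :
  (forall C (d : deduction C),
     (forall pr, In pr (premises d) -> P _ (premise_deduction pr)) -> P C d) ->
  forall C (d : deduction C), P C d.
Proof.
  intros step C d; induction d; apply step; simpl; intuition; subst; assumption.
Qed.

Lemma formula_size_bounded (atom : Type) (C : formula atom) (d : deduction C) :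
  exists M, forall p F, occurs_at d p F -> formula_size F <= M.
Proof.
  induction d as [C d IH] using deduction_premises_ind.
  assert (Hl : exists M, forall pr, In pr (premises d) ->
            forall p F, occurs_at (premise_deduction pr) p F ->
            formula_size F <= M).
  { induction (premises d) as [| pr l IHl].
    - exists 0; intros pr [].
    - destruct (IH pr (or_introl eq_refl)) as [M1 H1].
      destruct IHl as [M2 H2]; [intros; apply IH; right; assumption |].
      exists (M1 + M2); intros pr' [<- | Hin] p F Hp.
      + specialize (H1 _ _ Hp); lia.
      + specialize (H2 _ Hin _ _ Hp); lia. }
  destruct Hl as [M HM].
  exists (formula_size C + M); intros [| k p] F [e He]; simpl in He.
  - injection He as HF _; subst; lia.
  - destruct (nth_error (premises d) k) as [pr |] eqn:Hk; [| discriminate].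
    enough (formula_size F <= M) by lia.
    apply (HM pr (nth_error_In _ _ Hk) p); exists e; assumption.
Qed.

Section Positions.

Variables (atom : Type) (C : formula atom) (d : deduction C).

Lemma premise_at_fun q k pr pr' :
  premise_at d q k pr -> premise_at d q k pr' -> pr = pr'.
Proof.
  intros (B & e & He & Hk) (B' & e' & He' & Hk').
  rewrite He in He'.
  (* Mapping both dependent pairs to a non-dependent value avoids inverting an equality of pairs. *)
  apply (f_equal (fun o => match o with
    | Some s => nth_error (premises (projT2 s)) k
    | None => None
    end)) in He'.
  simpl in He'; congruence.
Qed.

Lemma occurs_at_fun p F G : occurs_at d p F -> occurs_at d p G -> F = G.
Proof. intros [e He] [e' He']; congruence. Qed.

Lemma premise_of_role_fun r r' p q q' :
  premise_of_role d r p q -> premise_of_role d r' p q' -> r = r'.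
Proof.
  intros (k & pr & -> & Hpr & <-) (k' & pr' & Heq & Hpr' & <-).
  apply app_inj_tail in Heq as [-> ->].
  f_equal; eapply premise_at_fun; eassumption.
Qed.

Lemma subdeduction_app p r :
  subdeduction d (p ++ r) =
  match subdeduction d p with
  | Some s => subdeduction (projT2 s) r
  | None => None
  end.
Proof.
  revert C d; induction p as [| k p IH]; intros D e; simpl; [reflexivity |].
  destruct (nth_error (premises e) k); [apply IH | reflexivity].
Qed.

Lemma premise_at_subdeduction q k pr :
  premise_at d q k pr ->
  subdeduction d (q ++ [k]) = Some (existT _ _ (premise_deduction pr)).
Proof.
  intros (B & e & He & Hk).
  rewrite subdeduction_app, He; simpl; rewrite Hk; reflexivity.
Qed.

Lemma occurs_at_snoc q k F :
  occurs_at d (q ++ [k]) F ->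
  exists pr, premise_at d q k pr /\ premise_formula pr = F.
Proof.
  intros [e He]; rewrite subdeduction_app in He.
  destruct (subdeduction d q) as [[B f] |] eqn:Hq; [| discriminate].
  simpl in He; destruct (nth_error (premises f) k) as [pr |] eqn:Hk;
    [| discriminate].
  exists pr; split; [exists B, f; auto | congruence].
Qed.

(** A major premise is not atomic, so [BotE] cannot conclude it; any other rule would have an
    arbitrary premise that starts a maximal segment. *)
Lemma major_premise_is_assumption p F :
  BotE_atomic d -> ~ (exists s, maximal_segment d s) ->
  major_premise d p -> occurs_at d p F -> exists x, assumption_at d p F x.
Proof.
  intros Hbot Hseg Hmaj [e He].
  destruct (deduction_last_rule e) as [[x ->] | [[e' ->] | (k & pr & Hk & Harb)]].
  - exists x; assumption.
  - exfalso; destruct (Hbot _ _ _ He) as [a ->].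
    destruct Hmaj as (q & k & pr & -> & Hpr & Hrole).
    pose proof (premise_at_subdeduction Hpr) as Hsub.
    destruct Hpr as (B & f & _ & Hk).
    apply (@major_premise_not_atomic _ _ f pr a (nth_error_In _ _ Hk) Hrole).
    congruence.
  (* A segment may begin anywhere, so two occurrences suffice; it ends at [p] because a major
     premise is not arbitrary. *)
  - exfalso; apply Hseg; exists [p ++ [k]; p].
    assert (Hpr : premise_at d p k pr) by (exists F, e; auto).
    split; [| exact Hmaj].
    split; [simpl; lia | split; [| split]].
    + exists F; intros r [<- | [<- | []]].
      * rewrite <- (arbitrary_premise_formula e pr (nth_error_In _ _ Hk) Harb).
        exists (premise_deduction pr); apply premise_at_subdeduction, Hpr.
      * exists e; exact He.
    + intros [| [| i]] r q Hr Hq; simpl in Hr, Hq; try discriminate.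
      injection Hr as <-; injection Hq as <-; exists k, pr; auto.
    + simpl; intros [q Hq]; destruct Hmaj as [q' Hq'].
      discriminate (premise_of_role_fun Hq Hq').
Qed.

Lemma principal_formula_occurs q B (e : deduction B) G :
  no_vacuous_discharge d -> subdeduction d q = Some (existT _ B e) ->
  principal_formula e G -> exists p, occurs_at d p G.
Proof.
  intros Hvac He (k & pr & Hk & HG).
  assert (Hpr : premise_at d q k pr) by (exists B, e; auto).
  destruct HG as [[_ <-] | [Harb [y Hy]]].
  - exists (q ++ [k]), (premise_deduction pr).
    apply premise_at_subdeduction, Hpr.
  - destruct (Hvac _ _ _ Hpr Harb) as (p & F & x & Hp & Hscope & _).
    destruct Hscope as [_ (pr' & Hpr' & Hin)].
    (* Only one class is discharged here, so the occurrence given by non-vacuity must be one of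
       [G]. *)
    rewrite (premise_at_fun Hpr' Hpr), Hy in Hin.
    destruct Hin as [Heq | []]; injection Heq as -> _.
    exists p; eexists; exact Hp.
Qed.

Hypotheses (Hdischarge : no_vacuous_discharge d) (Hbot : BotE_atomic d)
  (Hnormal : normal_form d).

Lemma normal_major_premise p F :
  major_premise d p -> occurs_at d p F ->
  undischarged_assumption d p F \/
  exists p' G, occurs_at d p' G /\ proper_subformula F G.
Proof.
  intros Hmaj Hp; destruct Hnormal as [Hmax Hseg].
  destruct (major_premise_is_assumption Hbot Hseg Hmaj Hp) as [x Hx].
  destruct (classic (exists q k, discharged_by d p q k)) as [(q & k & Hdis) | Hun];
    [right | left; split; eauto].
  pose proof Hdis as (F' & x' & Hx' & [_ (pr & Hpr & Hin)] & _).
  assert (F' = F) as -> by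
    (eapply occurs_at_fun; eexists; [exact Hx' | exact Hx]).
  pose proof Hpr as (B & e & He & Hk).
  destruct (discharged_class_principal e pr F x' (nth_error_In _ _ Hk) Hin)
    as [[Hintro Harb] | (G & HG & HFG)].
  (* Discharged by an introduction above its arbitrary premise, [p] would be a maximal formula. *)
  - exfalso; apply Hmax; exists p; split; [exact Hmaj |].
    exists q, k, pr; repeat split; try assumption.
    exists B, e; auto.
  - destruct (principal_formula_occurs q Hdischarge He HG) as [p' Hp']; eauto.
Qed.

Lemma normal_subformula_property : subformula_property d.
Proof.
  destruct (formula_size_bounded d) as [M HM].
  (* The measure [M - formula_size F] drops whenever the search moves to a larger formula. *)
  assert (Hmain : forall n p F, M - formula_size F < n -> occurs_at d p F ->
    subformula F C \/
    exists q G, undischarged_assumption d q G /\ subformula F G).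
  { induction n as [| n IHn]; intros p F Hn Hp; [lia |].
    assert (Hlarger : forall p' G, occurs_at d p' G -> proper_subformula F G ->
      subformula F C \/
      exists q G', undischarged_assumption d q G' /\ subformula F G').
    { intros p' G HpG [HFG Hlt]; pose proof (HM _ _ HpG).
      destruct (IHn p' G) as [HC | (q & G' & Hq & HG')]; [lia | exact HpG | |].
      - left; eapply subformula_trans; eassumption.
      - right; exists q, G'; split; [exact Hq |].
        eapply subformula_trans; eassumption. }
    (* With [F] fixed, the inner induction descends towards the root, which removes the last entry
       of the path. *)
    clear IHn Hn; revert Hp; induction p as [| k q IHq] using rev_ind; intros Hp.
    - destruct Hp as [e He]; injection He as -> _; left; constructor.
    - destruct (occurs_at_snoc _ _ Hp) as (pr & Hpr & HF).
      pose proof Hpr as (B & e & He & Hk); apply nth_error_In in Hk.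
      destruct (premise_role pr) eqn:Hrole.
      + assert (Hmaj : major_premise d (q ++ [k])) by (exists q, k, pr; auto).
        destruct (normal_major_premise Hmaj Hp) as [Hun | (p' & G & HG & HFG)];
          [| eauto].
        right; exists (q ++ [k]), F; split; [exact Hun | constructor].
      + destruct (minor_premise_principal e pr Hk Hrole) as (G & HG & HFG).
        destruct (principal_formula_occurs q Hdischarge He HG) as [p' Hp'].
        apply (Hlarger p' G Hp'); congruence.
      + apply IHq; rewrite <- HF, (arbitrary_premise_formula e pr Hk Hrole).
        exists e; exact He. }
  intros p F; apply (Hmain (S M)); lia.
Qed.

End Positions.

Theorem theorem3 (atom : Type) (C : formula atom) (d : deduction C)
  (Hdischarge : no_vacuous_discharge d) (Hbot : BotE_atomic d)
  (Hnormal : normal_form d) : subformula_property d.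
Proof. exact (normal_subformula_property Hdischarge Hbot Hnormal). Qed.
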